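(* Let $\varphi$ be an $\mathfrak{S}_\infty$-central state on $\Gamma\wr\mathfrak{S}_\infty$, let $\pi_\varphi$ be the corresponding GNS-representation, let $\mathcal{M}=\pi_\varphi(\Gamma\wr\mathfrak{S}_\infty)''$ be the $W^*$-algebra generated by the operators $\pi_\varphi(g)$, $g\in\Gamma\wr\mathfrak{S}_\infty$, and let $\mathcal{C}$ be the center of $\mathcal{M}$. Suppose that $\varphi_1,\varphi_2$ are positive $\sigma$-weakly continuous linear functionals on $\mathcal{M}$ such that (i) $\varphi_k(\pi_\varphi(s)a)=\varphi_k(a\pi_\varphi(s))$ for all $s\in\mathfrak{S}_\infty$, $a\in\mathcal{M}$ and $k=1,2$; (ii) $\varphi_1(\mathfrak{c})=\varphi_2(\mathfrak{c})$ for all $\mathfrak{c}\in\mathcal{C}$. Then $\varphi_1(\mathfrak{a})=\varphi_2(\mathfrak{a})$ for all $\mathfrak{a}\in\pi_\varphi(\Gamma\wr\mathfrak{S}_\infty)$.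
   Context: $\mathfrak{S}_\infty$ is the (discrete) group of all bijections $s:\mathbb{N}\to\mathbb{N}$, $\mathbb{N}=\{1,2,\ldots\}$, moving only finitely many points. $\Gamma$ is a separable topological group with identity $e$; $\Gamma^\infty_e$ is the group of sequences $\gamma=(\gamma_1,\gamma_2,\ldots)$ in $\Gamma$ with only finitely many $\gamma_i\neq e$, with the inductive limit topology of the groups $\Gamma^n$. The wreath product $\Gamma\wr\mathfrak{S}_\infty=\Gamma^\infty_e\rtimes\mathfrak{S}_\infty$ carries the product topology; $\Gamma_e^\infty$ and $\mathfrak{S}_\infty$ are regarded as subgroups, each element is uniquely $s\gamma$ with $s\in\mathfrak{S}_\infty$, $\gamma\in\Gamma^\infty_e$, and $s(\gamma_1,\gamma_2,\ldots)s^{-1}=(\gamma_{s^{-1}(1)},\gamma_{s^{-1}(2)},\ldots)$. A state on a topological group $G$ is a continuous positive definite function $\varphi$ with $\varphi(e)=1$. A state $\varphi$ on $\Gamma\wr\mathfrak{S}_\infty$ is $\mathfrak{S}_\infty$-central if $\varphi(gs)=\varphi(sg)$ for all $g\in\Gamma\wr\mathfrak{S}_\infty$, $s\in\mathfrak{S}_\infty$. The GNS-representation $\pi_\varphi$ has cyclic vector $\xi_\varphi$ with $\varphi(g)=(\pi_\varphi(g)\xi_\varphi,\xi_\varphi)$. *)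

(* Defs.v *)
From HB Require Import structures.
From mathcomp Require Import all_boot all_order all_algebra.
From mathcomp Require Import all_classical all_reals all_analysis.
From mathcomp Require Import complex.

Set Implicit Arguments.
Unset Strict Implicit.
Unset Printing Implicit Defensive.

Import Order.TTheory GRing.Theory Num.Theory.
Import numFieldNormedType.Exports.

Local Open Scope classical_set_scope.
Local Open Scope group_scope.
Local Open Scope ring_scope.

(* The numFieldType-keyed instances of numFieldNormedType.Exports do not fire on
   the concrete type R[i]. *)
HB.instance Definition _ (R : realType) := NormedModule.copy R[i] R[i]^o.

HB.structure Definition PreTopologicalGroup :=
  {G of Group G & Topological G}.

HB.mixin Record PreTopologicalGroup_isTopologicalGroup G
    & PreTopologicalGroup G := {
  mulg_continuous : continuous (fun x : G * G => (x.1 * x.2)%g);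
  invg_continuous : continuous (fun x : G => x^-1%g)
}.

#[short(type="topologicalGroupType")]
HB.structure Definition TopologicalGroup :=
  {G of PreTopologicalGroup G & PreTopologicalGroup_isTopologicalGroup G}.

Definition separable (T : topologicalType) : Prop :=
  exists2 D : set T, countable D & dense D.

(* Positive integers are represented by nat, shifted to start from 0. *)
Record finperm := FinPerm {
  finperm_fun :> nat -> nat;
  finperm_bij : bijective finperm_fun;
  finperm_fin : finite_set [set i | finperm_fun i != i]
}.

HB.instance Definition _ := gen_eqMixin finperm.
HB.instance Definition _ := gen_choiceMixin finperm.

Lemma finpermP (s t : finperm) : s =1 t -> s = t.
Proof.
case: s t => [f bf ff] [g bg fg] /= /funext efg.
by rewrite efg in bf ff *; congr FinPerm; exact: Prop_irrelevance.
Qed.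

Lemma finperm_inv_ex (s : finperm) : exists t : finperm, cancel s t /\ cancel t s.
Proof.
have [g sg gs] := finperm_bij s.
have gf : finite_set [set i | g i != i].
  apply: sub_finite_set (finperm_fin s) => i /= gi; apply: contra_neq gi => si.
  by rewrite -{1}si sg.
by exists (FinPerm (Bijective gs sg) gf).
Qed.

Lemma finperm_one_fin : finite_set [set i : nat | idfun i != i].
Proof. by apply: sub_finite_set (finite_set0 nat) => i /=; rewrite eqxx. Qed.

Definition finperm_one : finperm :=
  FinPerm (Bijective (frefl _) (frefl _)) finperm_one_fin.

Lemma finperm_mul_fin (s t : finperm) : finite_set [set i | (s \o t) i != i].
Proof.
have : finite_set ([set i | s i != i] `|` [set i | t i != i]).
  by rewrite finite_setU; split; exact: finperm_fin.
apply: sub_finite_set => i /=; case: (eqVneq (t i) i) => [->|]; first by left.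
by right.
Qed.

Definition finperm_mul (s t : finperm) : finperm :=
  FinPerm (bij_comp (finperm_bij s) (finperm_bij t)) (finperm_mul_fin s t).

Definition finperm_inv (s : finperm) : finperm := projT1 (cid (finperm_inv_ex s)).

Lemma finpermK (s : finperm) : cancel s (finperm_inv s).
Proof. by rewrite /finperm_inv; case: cid => t []. Qed.

Lemma finpermVK (s : finperm) : cancel (finperm_inv s) s.
Proof. by rewrite /finperm_inv; case: cid => t []. Qed.

Lemma finperm_mulA : associative finperm_mul.
Proof. by move=> s t u; exact: finpermP. Qed.

Lemma finperm_mul1 : left_id finperm_one finperm_mul.
Proof. by move=> s; exact: finpermP. Qed.

Lemma finperm_mulr1 : right_id finperm_one finperm_mul.
Proof. by move=> s; exact: finpermP. Qed.

Lemma finperm_mulV : left_inverse finperm_one finperm_inv finperm_mul.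
Proof. by move=> s; apply: finpermP => i /=; rewrite finpermK. Qed.

Lemma finperm_mulrV : right_inverse finperm_one finperm_inv finperm_mul.
Proof. by move=> s; apply: finpermP => i /=; rewrite finpermVK. Qed.

HB.instance Definition _ := isGroup.Build finperm
  finperm_mulA finperm_mul1 finperm_mulr1 finperm_mulV finperm_mulrV.

HB.instance Definition _ :=
  DiscreteTopology.copy finperm (discrete_topology finperm).

Section FinSeq.
Variable G : topologicalGroupType.

Record finseq := FinSeq {
  finseq_fun :> nat -> G;
  finseq_fin : finite_set [set i | finseq_fun i != 1%g]
}.

HB.instance Definition _ := gen_eqMixin finseq.
HB.instance Definition _ := gen_choiceMixin finseq.

Lemma finseqP (x y : finseq) : x =1 y -> x = y.
Proof.
case: x y => [f ff] [g fg] /= /funext efg.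
by rewrite efg in ff *; congr FinSeq; exact: Prop_irrelevance.
Qed.

Lemma finseq_one_fin : finite_set [set i : nat | 1%g != 1%g :> G].
Proof. by apply: sub_finite_set (finite_set0 nat) => i /=; rewrite eqxx. Qed.

Definition finseq_one : finseq := FinSeq finseq_one_fin.

Lemma finseq_mul_fin (x y : finseq) :
  finite_set [set i | (x i * y i)%g != 1%g].
Proof.
have : finite_set ([set i | x i != 1%g] `|` [set i | y i != 1%g]).
  by rewrite finite_setU; split; exact: finseq_fin.
apply: sub_finite_set => i /=; case: (eqVneq (x i) 1%g) => [->|]; last by left.
by rewrite mul1g; right.
Qed.

Definition finseq_mul (x y : finseq) : finseq := FinSeq (finseq_mul_fin x y).

Lemma finseq_inv_fin (x : finseq) : finite_set [set i | (x i)^-1%g != 1%g].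
Proof.
by apply: sub_finite_set (finseq_fin x) => i /=; rewrite invg_eq1.
Qed.

Definition finseq_inv (x : finseq) : finseq := FinSeq (finseq_inv_fin x).

Lemma finseq_perm_fin (x : finseq) (s : finperm) :
  finite_set [set i | (x \o s) i != 1%g].
Proof.
apply: sub_finite_set (finite_image (finperm_inv s) (finseq_fin x)) => i /= xi.
by exists (s i) => //; exact: finpermK.
Qed.

(* x \o s is the conjugate s^-1 x s. *)
Definition finseq_perm (x : finseq) (s : finperm) : finseq :=
  FinSeq (finseq_perm_fin x s).

Lemma finseq_of_prod_fin (n : nat) (x : 'I_n -> G) :
  finite_set [set i : nat | oapp x 1%g (insub i) != 1%g].
Proof.
apply: sub_finite_set (finite_II n) => i /=.
by case: insubP => [//|_]; rewrite eqxx.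
Qed.

(* (x_0, ..., x_(n-1)) |-> (x_0, ..., x_(n-1), 1, 1, ...) *)
Definition finseq_of_prod (n : nat) (x : {ptws 'I_n -> G}) : finseq :=
  FinSeq (finseq_of_prod_fin x).

(* Inductive limit topology: the final topology of the embeddings. *)
Definition finseq_open : set_system finseq :=
  [set U | forall n, open (@finseq_of_prod n @^-1` U)].

Lemma finseq_openT : finseq_open setT.
Proof. by move=> n; rewrite preimage_setT; exact: openT. Qed.

Lemma finseq_openI : setI_closed finseq_open.
Proof. by move=> U V oU oV n; rewrite preimage_setI; exact: openI. Qed.

Lemma finseq_open_bigU (I : Type) (f : I -> set finseq) :
  (forall i, finseq_open (f i)) -> finseq_open (\bigcup_i f i).
Proof.
by move=> of_ n; rewrite preimage_bigcup; apply: bigcup_open => i _; exact: of_.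
Qed.

HB.instance Definition _ := isOpenTopological.Build finseq
  finseq_openT finseq_openI finseq_open_bigU.

End FinSeq.

(* The pair (s, x) stands for the product s x. The topology is the product
   topology; multiplication need not be jointly continuous for the inductive
   limit topology, hence no TopologicalGroup structure. *)
Definition wreath (G : topologicalGroupType) : Type := (finperm * finseq G)%type.

Section Wreath.
Variable G : topologicalGroupType.

HB.instance Definition _ := Choice.copy (wreath G) (finperm * finseq G)%type.
HB.instance Definition _ := Topological.copy (wreath G) (finperm * finseq G)%type.

Definition wreath_one : wreath G := (1%g, finseq_one G).

(* (s x) (t y) = (s t) ((t^-1 x t) y) *)
Definition wreath_mul (g h : wreath G) : wreath G :=
  ((g.1 * h.1)%g, finseq_mul (finseq_perm g.2 h.1) h.2).

(* (s x)^-1 = s^-1 (s x^-1 s^-1) *)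
Definition wreath_inv (g : wreath G) : wreath G :=
  ((g.1^-1)%g, finseq_perm (finseq_inv g.2) (g.1^-1)%g).

Lemma wreath_mulA : associative wreath_mul.
Proof.
move=> g h k; congr pair; first exact: mulgA.
by apply: finseqP => i /=; rewrite mulgA.
Qed.

Lemma wreath_mul1 : left_id wreath_one wreath_mul.
Proof.
case=> s x; congr pair; first exact: mul1g.
by apply: finseqP => i /=; rewrite mul1g.
Qed.

Lemma wreath_mulr1 : right_id wreath_one wreath_mul.
Proof.
case=> s x; congr pair; first exact: mulg1.
by apply: finseqP => i /=; rewrite mulg1.
Qed.

Lemma wreath_mulV : left_inverse wreath_one wreath_inv wreath_mul.
Proof.
case=> s x; congr pair; first exact: mulVg.
by apply: finseqP => i /=; rewrite (finpermK s) mulVg.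
Qed.

Lemma wreath_mulrV : right_inverse wreath_one wreath_inv wreath_mul.
Proof.
case=> s x; congr pair; first exact: mulgV.
by apply: finseqP => i /=; rewrite mulgV.
Qed.

HB.instance Definition _ := isGroup.Build (wreath G)
  wreath_mulA wreath_mul1 wreath_mulr1 wreath_mulV wreath_mulrV.

Definition wreath_perm (s : finperm) : wreath G := (s, finseq_one G).

End Wreath.

(* The convention s (x_1, x_2, ...) s^-1 = (x_(s^-1(1)), x_(s^-1(2)), ...). *)
Lemma wreath_conj (G : topologicalGroupType) (s : finperm) (x : finseq G) :
  (wreath_perm G s * (1, x) * (wreath_perm G s)^-1)%g
  = (1%g, finseq_perm x (s^-1)%g) :> wreath G.
Proof.
congr pair; first by rewrite /= mulg1 mulgV.
by apply: finseqP => i /=; rewrite mul1g invg1 mulg1.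
Qed.

Definition positive_definite (R : realType) (G : groupType) (phi : G -> R[i]) :=
  forall (n : nat) (g : 'I_n -> G) (c : 'I_n -> R[i]),
    0 <= \sum_(i < n) \sum_(j < n) c i * (c j)^* * phi ((g j)^-1 * g i)%g.

Definition state (R : realType) (G : PreTopologicalGroup.type) (phi : G -> R[i]) :=
  [/\ continuous phi, positive_definite phi & phi 1%g = 1].

Definition finperm_central (R : realType) (G : topologicalGroupType)
    (phi : wreath G -> R[i]) :=
  forall (g : wreath G) (s : finperm),
    phi (g * wreath_perm G s)%g = phi (wreath_perm G s * g)%g.

HB.mixin Record CompleteNormedModule_isHilbert (R : realType) H
    & CompleteNormedModule R[i] H := {
  inner : H -> H -> R[i];
  inner_linear : forall y, scalar (inner^~ y);
  inner_conj : forall x y, inner y x = (inner x y)^*;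
  inner_norm : forall x, inner x x = `|x| ^+ 2
}.

#[short(type="hilbertType")]
HB.structure Definition Hilbert (R : realType) :=
  {H of CompleteNormedModule R[i] H & CompleteNormedModule_isHilbert R H}.

Section Operators.
Variables (R : realType) (H : hilbertType R).
Implicit Types (A B T : H -> H) (M S : set (H -> H)).

Definition bounded_operators : set (H -> H) :=
  [set T | linear T /\ continuous T].

Definition commutant S : set (H -> H) :=
  [set T | bounded_operators T /\ forall A, S A -> T \o A = A \o T].

Definition center_of M : set (H -> H) := M `&` commutant M.

Definition adjoint_of A B := forall x y, inner (A x) y = inner x (B y).

Definition square_summable (x : nat -> H) : Prop :=
  cvgn (series (fun n => `|x n| ^+ 2 : R[i])).

Definition square_summable_pair : Type :=
  {xy : (nat -> H) * (nat -> H) | square_summable xy.1 /\ square_summable xy.2}.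

HB.instance Definition _ := gen_eqMixin square_summable_pair.
HB.instance Definition _ := gen_choiceMixin square_summable_pair.

(* The series converges when T is a bounded operator. *)
Definition sigma_weak_coord T : {ptws square_summable_pair -> R[i]} :=
  fun xy => limn (series (fun n => inner (T ((sval xy).1 n)) ((sval xy).2 n))).

(* Coarsest topology making T |-> \sum_n (T x_n, y_n) continuous for all
   square-summable sequences x and y. It is only used on sets of bounded
   operators. *)
Definition sigma_weak_topology : Type := initial_topology sigma_weak_coord.

HB.instance Definition _ :=
  Topological.copy sigma_weak_topology (initial_topology sigma_weak_coord).

(* A functional on M is a function on all operators, of which only the
   restriction to M matters. *)
Definition linear_functional_on M (f : (H -> H) -> R[i]) :=
  forall (c : R[i]) A B, M A -> M B -> f (c *: A + B) = c * f A + f B.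

Definition positive_on M (f : (H -> H) -> R[i]) :=
  forall A B, M A -> M B -> adjoint_of A B -> 0 <= f (B \o A).

Definition sigma_weakly_continuous_on M (f : (H -> H) -> R[i]) :=
  {within (M : set sigma_weak_topology),
    continuous (f : sigma_weak_topology -> R[i])}.

End Operators.

Section GNS.
Variables (R : realType) (G : groupType) (H : hilbertType R).

Definition unitary_representation (pi : G -> H -> H) :=
  [/\ forall g, linear (pi g),
      pi 1%g = idfun,
      forall g h, pi (g * h)%g = pi g \o pi h
    & forall g x y, inner (pi g x) (pi g y) = inner x y].

Definition cyclic_vector (pi : G -> H -> H) (xi : H) :=
  dense [set v : H | exists n (c : 'I_n -> R[i]) (g : 'I_n -> G),
    v = \sum_(i < n) c i *: pi (g i) xi].

(* Such a pair (pi, xi) is unique up to unitary equivalence. *)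
Definition GNS_representation (phi : G -> R[i]) (pi : G -> H -> H) (xi : H) :=
  [/\ unitary_representation pi, cyclic_vector pi xi
    & forall g, phi g = inner (pi g xi) xi].

(* The set of all pi g is self-adjoint, so its bicommutant is the W*-algebra it
   generates. *)
Definition generated_algebra (pi : G -> H -> H) : set (H -> H) :=
  commutant (commutant (range pi)).

End GNS.

(* Main.v *)
Require Import Defs.
From HB Require Import structures.
From mathcomp Require Import all_boot all_order all_algebra.
From mathcomp Require Import all_classical all_reals all_analysis.
From mathcomp Require Import complex ring zify.

Set Implicit Arguments.
Unset Strict Implicit.
Unset Printing Implicit Defensive.

Import Order.TTheory GRing.Theory Num.Theory.
Import numFieldNormedType.Exports.

Local Open Scope classical_set_scope.
Local Open Scope ring_scope.

(** Let [g] be an element of the wreath product. Its support is finite, so it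
    has conjugates [g_n] by finitary permutations whose supports are pairwise
    disjoint ([copy]). A functional as in the theorem takes the same value at
    [pi g] and at every [pi g_n]. If the operators [pi g_n], or suitable means
    of them, have a limit [A] in the sigma-weak topology, then [A] lies in the
    algebra, and it commutes with every [pi h] because the supports of [g_n] and
    [h] are disjoint for large [n]. So [A] is central, and the value of the
    functional at [pi g] is its value at [A], which is determined by the
    restriction to the center.

    The limit is obtained for means, in the strong topology. The inner products
    [(pi g_n (pi h xi), pi g_m (pi h xi)) = phi ((g_m h)^-1 (g_n h))] do not
    depend on the pair of distinct large indices [n], [m], since a finitary
    permutation that fixes the support of [h] moves any such pair to any other
    and [phi] is central ([copy_gram]). A sequence of vectors with such a Gram
    matrix has convergent means ([window_mean_cvg]). The vectors [pi h xi] span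
    a dense subspace and all the means are contractions, so the means converge
    at every vector ([copy_mean_cvg]). For contractions strong convergence
    implies sigma-weak convergence, by dominated convergence of series
    ([contraction_sigma_weak_cvg]). *)

(** * Limits and dominated series of complex numbers *)

Lemma cauchy_seq (K : numFieldType) (V : normedModType K) (u : nat -> V) :
  (forall e : K, 0 < e -> exists n, forall m, (n <= m)%N -> `|u n - u m| < e) ->
  cauchy (u @ \oo).
Proof.
move=> cu; apply: cauchy_exP => e /cu[n un].
by exists (u n), n => // m /= nm; rewrite -ball_normE; exact: un.
Qed.

Lemma norm_lim_le (K : numFieldType) (V : normedModType K) (u : nat -> V)
    (a l : V) (e : K) :
  u @ \oo --> l -> (\forall n \near \oo, `|u n - a| <= e) -> `|l - a| <= e.
Proof.
move=> /cvgrPdist_le ul ua; apply/ler_addgt0Pl => d d0.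
have [n [un uan]] : exists n, `|l - u n| <= d /\ `|u n - a| <= e.
  by have [n /= []] := filter_ex (filterI (ul _ d0) ua); exists n.
by rewrite -(subrK (u n) l) -addrA (le_trans (ler_normD _ _))// lerD.
Qed.

Lemma cvg_finite_sum (K : numFieldType) (V : normedModType K) (I : Type)
    (r : seq I) (u : I -> nat -> V) (l : I -> V) :
  (forall i, u i @ \oo --> l i) ->
  \sum_(i <- r) u i N @[N --> \oo] --> \sum_(i <- r) l i.
Proof. by move=> ul; apply: cvg_big => // -[x y]; exact: add_continuous. Qed.

Lemma complex_archi (R : realType) (C e : R[i]) : 0 <= C -> 0 < e ->
  exists N : nat, C / N.+1%:R < e.
Proof.
case: C => C C' /=; rewrite lecE /= => /andP[/eqP -> C0].
case: e => e e'; rewrite ltcE /= => /andP[/eqP -> e0].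
exists (Num.truncn (C / e)).
rewrite ltr_pdivrMr ?ltr0n//.
rewrite -(rmorph_nat (real_complex R)).
rewrite -[ltRHS](rmorphM (real_complex R)) ltcR mulrC -ltr_pdivrMr//.
exact: truncnS_gt.
Qed.

(** The real and imaginary parts of a Cauchy sequence are Cauchy sequences of
    the complete field [R]. The bound on the imaginary part of [z] comes
    from [Re (z * 'i) = - Im z]. *)
Lemma complex_complete (R : realType) (u : nat -> R[i]) :
  cauchy (u @ \oo) -> cvgn u.
Proof.
move=> /cauchy_ballP cu.
have norm_i : `|'i%C : R[i]| = 1.
  by rewrite normc_def /= expr0n add0r expr1n sqrtr1.
have part (f : R[i] -> R) : {morph f : x y / x - y} ->
    (forall z, (`|f z|%:C)%C <= `|z|) -> cvgn (f \o u).
  move=> fB fn; apply/cauchy_cvgP/cauchy_ballP => e e0.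
  have e0' : 0 < (e%:C)%C :> R[i] by rewrite ltcR.
  have [[A B] /= [nA nB] AB] := cu _ e0'.
  have img S : (\forall n \near \oo, S (u n)) ->
      \forall n \near \oo, (f @` S) (f (u n)).
    by apply: filterS => n Sn; exists (u n).
  exists (f @` A, f @` B) => /=; first by split; exact: img.
  case=> _ _ /= [[x Ax <-] [y By <-]]; have := AB (x, y) (conj Ax By).
  rewrite -!ball_normE /= => h.
  by rewrite -ltcR -fB (le_lt_trans _ h).
have Ren := part (@complex.Re R) (raddfB _) (@normc_ge_Re R).
have Imn : cvgn (@complex.Im R \o u).
  apply: part => [|z]; first exact: raddfB.
  rewrite -normrN -ReiNIm (le_trans (normc_ge_Re _))// normrM.
  by rewrite norm_i mulr1.
have eC (x y : R) : (x +i* y)%C = x%:C%C + 'i%C * y%:C%C := complexE (x +i* y)%C.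
apply/cvg_ex.
exists (limn (@complex.Re R \o u) +i* limn (@complex.Im R \o u))%C.
apply/cvgrPdist_le => e e0.
have [d d0 de] : exists2 d : R, 0 < d & (d%:C%C + d%:C%C <= e).
  move: e0; case: e => e e'; rewrite ltcE /= => /andP[/eqP -> e0].
  exists (e / 2); first by rewrite divr_gt0.
  by rewrite -rmorphD -splitr.
move/cvgrPdist_le : Ren => /(_ _ d0) Ren.
move/cvgrPdist_le : Imn => /(_ _ d0) Imn.
near=> n; rewrite [u n]complexE eC opprD addrACA -mulrBr -!rmorphB.
rewrite (le_trans (ler_normD _ _))// (le_trans _ de)// lerD//.
  by rewrite normc_def /= expr0n addr0 sqrtr_sqr lecR; near: n.
rewrite normrM norm_i mul1r.
by rewrite normc_def /= expr0n addr0 sqrtr_sqr lecR; near: n.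
Unshelve. all: by end_near. Qed.

Section DominatedSeries.
Variables (R : realType) (b : nat -> R[i]).
Hypothesis b_cvg : cvgn (series b).

(** The point is the uniformity: the same [m] serves for all dominated [z]. *)
Lemma dominated_tail (e : R[i]) : 0 < e -> exists m, forall z : nat -> R[i],
  (forall n, `|z n| <= b n) ->
  forall p, (m <= p)%N -> `|series z p - series z m| < e.
Proof.
move=> e0.
have /cvgrPdist_lt/(_ (e / 2)) := b_cvg.
rewrite divr_gt0// => /(_ isT)[m _ bm].
exists m => z zb p mp.
have sE (w : nat -> R[i]) : series w p - series w m = \sum_(m <= k < p) w k.
  by rewrite sub_series_geq.
rewrite sE (le_lt_trans (ler_norm_sum _ _ _))//.
rewrite (@le_lt_trans _ _ (\sum_(m <= k < p) b k))//; first exact: ler_sum.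
have b0 : 0 <= \sum_(m <= k < p) b k.
  by apply: sumr_ge0 => k _; exact: le_trans (zb k).
rewrite -(ger0_norm b0) -sE.
have := bm p mp; have := bm m (leqnn m) => /= h1 h2.
rewrite (splitr e) -(subrK (limn (series b)) (series b p)) -addrA.
by rewrite (le_lt_trans (ler_normD _ _))// ltrD// distrC.
Qed.

Lemma dominated_series_cvg (z : nat -> R[i]) :
  (forall n, `|z n| <= b n) -> cvgn (series z).
Proof.
move=> zb; apply: complex_complete; apply: cauchy_seq => e /dominated_tail[m zm].
by exists m => p mp; rewrite distrC zm.
Qed.

(** Dominated convergence for series: up to two uniformly small tails, only a
    finite sum has to pass to the limit. *)
Lemma dominated_series_lim (z : nat -> nat -> R[i]) (w : nat -> R[i]) :
  (forall N n, `|z N n| <= b n) -> (forall n, `|w n| <= b n) ->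
  (forall n, z N n @[N --> \oo] --> w n) ->
  limn (series (z N)) @[N --> \oo] --> limn (series w).
Proof.
move=> zb wb zw; apply/cvgrPdist_le => e e0.
have e3 : 0 < e / 3 by rewrite divr_gt0.
have [m tail] := dominated_tail e3.
have lim_tail (v : nat -> R[i]) : (forall n, `|v n| <= b n) ->
    `|limn (series v) - series v m| <= e / 3.
  move=> vb; apply: norm_lim_le; first exact: dominated_series_cvg vb.
  by exists m => // p /= mp; rewrite ltW// tail.
have /cvgrPdist_le/(_ _ e3) zwm : series (z N) m @[N --> \oo] --> series w m.
  exact: cvg_finite_sum.
near=> N.
have -> : e = e / 3 + (e / 3 + e / 3) by field.
rewrite -(subrK (series w m) (limn (series w))) -addrA.
rewrite (le_trans (ler_normD _ _))// lerD ?lim_tail//.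
rewrite -(subrK (series (z N) m) (series w m)) -addrA.
rewrite (le_trans (ler_normD _ _))// lerD ?[`|_ - limn _|]distrC ?lim_tail//.
by near: N.
Unshelve. all: by end_near. Qed.

End DominatedSeries.

(** * Inner products and convergence of means *)

Section Inner.
Variables (R : realType) (H : hilbertType R).
Implicit Types (x y z : H) (a : R[i]).

Lemma innerDl x y z : inner (x + y) z = inner x z + inner y z.
Proof. by have := inner_linear z 1 x y; rewrite !scale1r mul1r. Qed.

Lemma inner0l z : inner 0 z = 0.
Proof. by apply: (@addIr _ (inner 0 z)); rewrite -innerDl !add0r. Qed.

Lemma innerZl a x z : inner (a *: x) z = a * inner x z.
Proof. by have := inner_linear z a x 0; rewrite !addr0 inner0l addr0. Qed.

Lemma innerBl x y z : inner (x - y) z = inner x z - inner y z.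
Proof. by rewrite innerDl -scaleN1r innerZl mulN1r. Qed.

Lemma innerDr x y z : inner z (x + y) = inner z x + inner z y.
Proof.
by rewrite (inner_conj (x + y)) innerDl rmorphD (inner_conj x z) (inner_conj y z).
Qed.

Lemma innerZr a x z : inner z (a *: x) = a^* * inner z x.
Proof. by rewrite (inner_conj (a *: x)) innerZl rmorphM (inner_conj x z). Qed.

Lemma innerBr x y z : inner z (x - y) = inner z x - inner z y.
Proof.
by rewrite (inner_conj (x - y)) innerBl rmorphB (inner_conj x z) (inner_conj y z).
Qed.

Lemma inner_suml (I : Type) (r : seq I) (v : I -> H) z :
  inner (\sum_(i <- r) v i) z = \sum_(i <- r) inner (v i) z.
Proof. exact: (big_morph (inner^~ z) (fun x y => innerDl x y z) (inner0l z)). Qed.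

Lemma inner_sumr (I : Type) (r : seq I) (v : I -> H) z :
  inner z (\sum_(i <- r) v i) = \sum_(i <- r) inner z (v i).
Proof.
rewrite inner_conj inner_suml rmorph_sum /=; apply: eq_bigr => i _.
exact/esym/inner_conj.
Qed.

Lemma inner_cauchy_schwarz x y : `|inner x y| <= `|x| * `|y|.
Proof.
have [->|y0] := eqVneq y 0.
  by rewrite normr0 mulr0 inner_conj inner0l rmorph0 normr0.
have ny0 : 0 < `|y| by rewrite normr_gt0.
(* the squared distance of x to its orthogonal projection on the line of y *)
have : 0 <= inner (x - (inner x y / `|y| ^+ 2) *: y)
                  (x - (inner x y / `|y| ^+ 2) *: y).
  by rewrite inner_norm exprn_ge0.
rewrite !(innerBl, innerBr, innerZl, innerZr) (inner_conj x y) !inner_norm.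
rewrite rmorphM fmorphV rmorphXn /= (conj_Creal (ger0_real (normr_ge0 y))).
set a := inner x y; set Y := `|y|; set X := `|x|.
have Y0 : Y ^+ 2 != 0 by rewrite expf_neq0// gt_eqF.
rewrite [a^* / _ * (Y ^+ 2)]mulfVK// subrr subr0 mulrAC -normCKC.
rewrite subr_ge0 ler_pdivrMr ?exprn_gt0// -exprMn.
by rewrite ler_pXn2r ?nnegrE ?mulr_ge0 ?normr_ge0.
Qed.

Lemma inner_cvg (u : nat -> H) (x y : H) :
  u @ \oo --> x -> inner (u n) y @[n --> \oo] --> inner x y.
Proof.
move=> ux; apply/cvgrPdist_lt => e e0.
have d0 : 0 < e / (`|y| + 1) by rewrite divr_gt0// ltr_wpDl.
near=> n; rewrite -innerBl (le_lt_trans (inner_cauchy_schwarz _ _))//.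
rewrite (@le_lt_trans _ _ (`|x - u n| * (`|y| + 1)))// ?ler_wpM2l ?lerDl//.
rewrite -ltr_pdivlMr ?ltr_wpDl//.
by near: n; move/cvgrPdist_lt : ux; exact.
Unshelve. all: by end_near. Qed.

(** The window [N ^ 2, N ^ 2 + N] has [N + 1] elements, windows for different
    [N] are disjoint, and the window of [N] starts at [N] or later. So means
    over two different windows involve no common term, and any finite number
    of terms is eventually avoided. *)
Definition window_mean (v : nat -> H) (N : nat) : H :=
  N.+1%:R^-1 *: \sum_(k < N.+1) v (N ^ 2 + k)%N.

Lemma window_inj (N M k l : nat) : (k < N.+1)%N -> (l < M.+1)%N ->
  (N ^ 2 + k = M ^ 2 + l)%N -> N = M /\ k = l.
Proof. move=> kN lM e; suff NM : N = M by subst; lia. nia. Qed.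

(** A sequence whose Gram matrix is eventually constant on and off the diagonal
    is eventually a fixed vector plus an orthogonal sequence of vectors of
    constant length, so its means converge. The fixed vector is never
    constructed: the distance of two means is computed from the Gram matrix. *)
Section ConstantGram.
Variables (v : nat -> H) (n0 : nat) (r c : R[i]).
Hypothesis gram : forall n m, (n0 <= n)%N -> (n0 <= m)%N ->
  inner (v n) (v m) = if n == m then r else c.

Lemma inner_window_mean (N M : nat) : (n0 <= N)%N -> (n0 <= M)%N ->
  inner (window_mean v N) (window_mean v M) =
  c + (if N == M then (r - c) / N.+1%:R else 0).
Proof.
move=> n0N n0M; rewrite innerZl innerZr inner_suml.
rewrite fmorphV rmorph_nat.
have le n k : (n0 <= n)%N -> (n0 <= n ^ 2 + k)%N.
  by move=> h; apply: (leq_trans h); nia.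
have -> : \sum_(k < N.+1)
      inner (v (N ^ 2 + k)%N) (\sum_(l < M.+1) v (M ^ 2 + l)%N) =
    \sum_(k < N.+1) (c * M.+1%:R + (if N == M then r - c else 0)).
  apply: eq_bigr => k _; rewrite inner_sumr.
  have [NM|NM] := eqVneq N M; last first.
    rewrite addr0 (eq_bigr (fun=> c)) ?sumr_const ?card_ord ?mulr_natr// => l _.
    rewrite gram ?le//; case: eqP => // /window_inj[]// /eqP.
    by rewrite (negbTE NM).
  subst M.
  rewrite (eq_bigr (fun l => c + (if l == k then r - c else 0))) => [|l _].
    rewrite big_split /= sumr_const card_ord mulr_natr; congr (_ + _).
    by rewrite -big_mkcond big_pred1_eq.
  rewrite gram ?le// eqn_add2l eq_sym -val_eqE /=.
  by case: ifP; rewrite ?addr0// addrC subrK.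
rewrite sumr_const card_ord -mulr_natr.
have N0 : N.+1%:R != 0 :> R[i] by rewrite pnatr_eq0.
have M0 : M.+1%:R != 0 :> R[i] by rewrite pnatr_eq0.
have [NM|NM] := eqVneq N M; first by subst M; field.
by field; rewrite !(addrC 1) !natr1 M0 N0.
Qed.

Lemma window_mean_cvg : cvgn (window_mean v).
Proof.
apply/cauchy_cvgP; apply: cauchy_seq => e e0.
(* r - c is half the squared distance of two terms *)
have rc : 0 <= r - c.
  have := @inner_norm R H (v n0 - v n0.+1).
  rewrite innerBl !innerBr !gram// !eqxx (ltn_eqF (ltnSn n0)) (gtn_eqF (ltnSn n0)).
  rewrite opprB -mulr2n => h.
  by rewrite -(pmulrn_lge0 _ (isT : 0 < 2)%N) h exprn_ge0.
have [N0 hN] := complex_archi (mulrn_wge0 2 rc) (exprn_gt0 2 e0).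
have dist N M : (n0 <= N)%N -> (n0 <= M)%N ->
    `|window_mean v N - window_mean v M| ^+ 2 <=
    (r - c) / N.+1%:R + (r - c) / M.+1%:R.
  move=> n0N n0M; rewrite -inner_norm innerBl !innerBr !inner_window_mean// !eqxx.
  rewrite (eq_sym M); case: eqP => [->|_].
    by rewrite !subrr addr_ge0// divr_ge0.
  by rewrite le_eqVlt; apply/orP; left; apply/eqP; ring.
exists (maxn n0 N0) => M; rewrite geq_max => /andP[n0M N0M].
rewrite -(@ltr_pXn2r _ 2)// ?nnegrE ?(ltW e0)//.
rewrite (le_lt_trans (dist _ _ (leq_maxl _ _) n0M))// (le_lt_trans _ hN)//.
rewrite mulrnAl mulr2n lerD// ler_wpM2l// lef_pV2 ?posrE ?ltr0n//.
  by rewrite ler_nat ltnS leq_maxr.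
by rewrite ler_nat ltnS.
Qed.

End ConstantGram.

End Inner.

(** * Limits of contractions *)

Lemma cvg_initial (S : choiceType) (T : topologicalType) (f : S -> T)
    (F : set_system S) (s : S) : Filter F ->
  f @ F --> f s -> F --> (s : initial_topology f).
Proof.
move=> FF fF A; rewrite nbhsE => -[_ [[B oB <-] Bs] sBA].
by apply: filterS sBA _; apply: fF; exact: open_nbhs_nbhs.
Qed.

Lemma cvg_ptws (I : Type) (T : topologicalType) (F : set_system {ptws I -> T})
    (f : {ptws I -> T}) : Filter F ->
  (forall i, g i @[g --> F] --> f i) -> F --> f.
Proof. by move=> FF gf; apply/cvg_sup => i; apply: cvg_initial; exact: gf. Qed.

Lemma is_cvg_series_add (K : numFieldType) (V : normedModType K)
    (f g : nat -> V) :
  cvgn (series f) -> cvgn (series g) -> cvgn (series (fun n => f n + g n)).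
Proof.
move=> fc gc; rewrite (_ : series _ = series f + series g); first exact: is_cvgD.
by apply/funext => n; rewrite /series /= big_split.
Qed.

Section Contraction.
Variables (R : realType) (H : hilbertType R).
Implicit Types (S T A : H -> H).

Definition contraction T := linear T /\ forall x, `|T x| <= `|x|.

Lemma linearB_prop T : linear T -> {morph T : x y / x - y}.
Proof. by move=> lT x y; rewrite -[x - y]addrC -scaleN1r lT scaleN1r addrC. Qed.

Lemma linear_comb T (I : Type) (r : seq I) (c : I -> R[i]) (v : I -> H) :
  linear T -> T (\sum_(i <- r) c i *: v i) = \sum_(i <- r) c i *: T (v i).
Proof.
move=> lT; elim: r => [|i r IH]; last by rewrite !big_cons lT IH.
by rewrite !big_nil; have := linearB_prop lT 0 0; rewrite !subrr.
Qed.

Lemma contraction_bounded T : contraction T -> bounded_operators T.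
Proof.
move=> [lT nT]; split=> // x; apply/cvgrPdist_lt => e e0.
near=> y; rewrite -(linearB_prop lT) (le_lt_trans (nT _))//.
Unshelve. all: by end_near. Qed.

Section StrongLimit.
Variables (S : nat -> H -> H) (D : set H).
Hypothesis contrS : forall N, contraction (S N).

Lemma contraction_cvg_dense : dense D ->
  (forall x, D x -> cvgn (fun N => S N x)) -> forall x, cvgn (fun N => S N x).
Proof.
move=> dD SD x; apply/cauchy_cvgP; apply: cauchy_seq => e e0.
have e3 : 0 < e / 3 by rewrite divr_gt0.
have [z [/= xz Dz]] : ball x (e / 3) `&` D !=set0.
  apply: dD; last exact: ball_open.
  by exists x; exact: ballxx.
have /cauchy_cvgP/cauchy_ballP := SD z Dz.
move=> /(_ _ e3)[[A B] /= [[n _ An] [m _ Bm]] AB].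
move: xz; rewrite -ball_normE /= => xz.
exists (maxn n m) => M; rewrite geq_max => /andP[nM mM].
have close k : `|S k x - S k z| < e / 3.
  by rewrite -(linearB_prop (contrS k).1) (le_lt_trans ((contrS k).2 _)).
have := AB (S (maxn n m) z, S M z) (conj (An _ (leq_maxl _ _)) (Bm _ mM)).
rewrite -ball_normE /= => nearz.
have -> : e = e / 3 + (e / 3 + e / 3) by field.
rewrite -(subrK (S (maxn n m) z) (S _ x)) -addrA.
rewrite (le_lt_trans (ler_normD _ _))// ltrD ?close//.
rewrite -(subrK (S M z) (S _ z)) -addrA.
by rewrite (le_lt_trans (ler_normD _ _))// ltrD// distrC.
Qed.

Variable A : H -> H.
Hypothesis SA : forall x, S N x @[N --> \oo] --> A x.

Lemma contraction_lim : contraction A.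
Proof.
split=> [a x y|x].
  have h : S N (a *: x + y) @[N --> \oo] --> a *: A x + A y.
    rewrite (_ : (fun N => S N _) = (fun N => a *: S N x + S N y)).
      by apply: cvgD; [exact: cvgZl_tmp|exact: SA].
    by apply/funext => N; rewrite (contrS N).1.
  exact: (cvg_unique (@norm_hausdorff _ H) (@SA _) h).
rewrite -[A x]subr0; apply: (norm_lim_le (@SA x)).
by near=> N; rewrite subr0; exact: (contrS N).2.
Unshelve. all: by end_near. Qed.

(** The uniform bound on the norms is essential: since
    [|(T x, y)| <= |x| * |y| <= |x|^2 + |y|^2] for every contraction [T], the
    series of all the operators have a common summable bound. *)
Lemma contraction_sigma_weak_cvg :
  (S : nat -> sigma_weak_topology H) @ \oo --> (A : sigma_weak_topology H).
Proof.
apply: cvg_initial; apply: cvg_ptws => -[[x y] [/= sx sy]].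
pose b (n : nat) : R[i] := `|x n| ^+ 2 + `|y n| ^+ 2.
have bc : cvgn (series b) by exact: is_cvg_series_add sx sy.
have dom T : contraction T -> forall n, `|inner (T (x n)) (y n)| <= b n.
  move=> [_ nT] n; rewrite (le_trans (inner_cauchy_schwarz _ _))//.
  rewrite (@le_trans _ _ (`|x n| * `|y n|))// ?ler_wpM2r//.
  rewrite /b /= -subr_ge0.
  have -> : `|x n| ^+ 2 + `|y n| ^+ 2 - `|x n| * `|y n| =
      (`|x n| - `|y n|) ^+ 2 + `|x n| * `|y n|.
    by ring.
  apply: addr_ge0; last exact: mulr_ge0.
  by rewrite real_exprn_even_ge0// rpredB// ger0_real.
apply: (dominated_series_lim bc) => [N n|n|n]; first exact: dom.
  exact: dom contraction_lim _.
exact: inner_cvg.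
Qed.

End StrongLimit.
End Contraction.

(** * Finitary permutations of blocks and conjugates with disjoint supports *)

Lemma finite_set_nat_bound (A : set nat) :
  finite_set A -> exists d, forall i, A i -> (i < d)%N.
Proof.
move=> /finite_seqP[s ->]; exists (\max_(j <- s) j).+1 => i /= si.
by rewrite ltnS; exact: leq_bigmax_seq.
Qed.

Section Swap.
Variables a b : nat.

Definition swap_fun (i : nat) : nat :=
  if i == a then b else if i == b then a else i.

Lemma swap_funK : involutive swap_fun.
Proof.
move=> i; rewrite /swap_fun.
case: (eqVneq i a) => [->|ia]; first by rewrite eqxx; case: (eqVneq b a).
by case: (eqVneq i b) => [->|ib]; rewrite ?eqxx// (negbTE ia) (negbTE ib).
Qed.

Lemma swap_fin : finite_set [set i | swap_fun i != i].
Proof.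
apply: sub_finite_set (finite_set2 a b) => i /=; rewrite /swap_fun.
case: (eqVneq i a) => [|_]; first by left.
by case: (eqVneq i b) => [|_]; [right|rewrite eqxx].
Qed.

Definition swap : finperm := FinPerm (inv_bij swap_funK) swap_fin.

Lemma swapL : swap a = b. Proof. by rewrite /= /swap_fun eqxx. Qed.

Lemma swapD i : i != a -> i != b -> swap i = i.
Proof. by rewrite /= /swap_fun => /negbTE -> /negbTE ->. Qed.

End Swap.

Lemma finperm_pair_transitive (n0 n m n' m' : nat) :
  (n0 <= n)%N -> (n0 <= m)%N -> (n0 <= n')%N -> (n0 <= m')%N ->
  n != m -> n' != m' ->
  exists t : finperm,
    [/\ t n = n', t m = m' & forall i, (i < n0)%N -> t i = i].
Proof.
move=> ln lm ln' lm' nm nm'; pose m2 := swap n n' m.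
have m2n' : n' != m2.
  apply: contra_neq nm => e; apply: (can_inj (swap_funK n n')).
  by rewrite -/(swap n n' : nat -> nat) -[RHS]e; exact: swapL.
have lm2 : (n0 <= m2)%N.
  by rewrite /m2 /= /swap_fun; case: eqP => // _; case: eqP.
(* first move n, which sends m to m2, then move m2 without touching n' *)
exists (swap m2 m' * swap n n')%g; split.
- change (swap m2 m' (swap n n' n) = n').
  by rewrite swapL swapD.
- exact: swapL.
- move=> i ii; have ne k : (n0 <= k)%N -> i != k.
    by move=> h; rewrite ltn_eqF// (leq_trans ii).
  change (swap m2 m' (swap n n' i) = i).
  by rewrite [swap n n' i]swapD ?ne// swapD ?ne.
Qed.

(** A permutation of the blocks of length [d.+1], carried out without changing
    the position inside the blocks. *)
Section Block.
Variable d : nat.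

Definition block_fun (t : nat -> nat) (i : nat) : nat :=
  (t (i %/ d.+1) * d.+1 + i %% d.+1)%N.

Lemma block_funE t n j : (j < d.+1)%N ->
  block_fun t (n * d.+1 + j) = (t n * d.+1 + j)%N.
Proof.
move=> jd.
by rewrite /block_fun divnMDl// divn_small// addn0 modnMDl modn_small.
Qed.

Lemma block_fun_fix t i : t (i %/ d.+1)%N = (i %/ d.+1)%N -> block_fun t i = i.
Proof. by rewrite /block_fun => ->; rewrite -divn_eq. Qed.

Lemma block_funK t u : cancel t u -> cancel (block_fun t) (block_fun u).
Proof.
move=> tK i; rewrite {2}/block_fun block_funE ?ltn_pmod// tK.
by rewrite -divn_eq.
Qed.

Lemma block_bij (t : finperm) : bijective (block_fun t).
Proof.
exists (block_fun (finperm_inv t)); apply: block_funK; first exact: finpermK.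
exact: finpermVK.
Qed.

Lemma block_fin (t : finperm) : finite_set [set i | block_fun t i != i].
Proof.
have [n tn] := finite_set_nat_bound (finperm_fin t).
apply: sub_finite_set (finite_II (n * d.+1)%N) => i /= ti.
rewrite ltnNge; apply: contra_neqN ti => ni; apply: block_fun_fix.
apply/eqP; apply: contraT => /tn; rewrite ltnNge => /negP[].
by rewrite leq_divRL.
Qed.

Definition block (t : finperm) : finperm := FinPerm (block_bij t) (block_fin t).

End Block.

Lemma mulVg_conj (T : groupType) (s a b : T) :
  ((s * a * s^-1)^-1 * (s * b * s^-1) = s * (a^-1 * b) * s^-1)%g.
Proof. by rewrite !invgM invgK !mulgA mulgVK. Qed.

Section Wreath.
Local Open Scope group_scope.
Variable G : topologicalGroupType.
Implicit Types (g h : wreath G) (s t : finperm).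

(** [i] lies outside the support of [g]. *)
Definition fixes g (i : nat) : bool := (g.1 i == i) && (g.2 i == 1).

Lemma wreathP g h : g.1 =1 h.1 -> g.2 =1 h.2 -> g = h.
Proof.
case: g h => [s x] [t y] /= st xy.
by congr pair; [exact: finpermP|exact: finseqP].
Qed.

Lemma fixes_commute g h : (forall i, fixes g i || fixes h i) -> g * h = h * g.
Proof.
suff key (u v : wreath G) i : (forall i, fixes u i || fixes v i) -> fixes v i ->
    (u.1 (v.1 i) = v.1 (u.1 i)) /\ (u.2 (v.1 i) * v.2 i = v.2 (u.1 i) * u.2 i).
  move=> gh; apply: wreathP => i.
    have /orP[fi|fi] := gh i; last exact: (key g h i gh fi).1.
    by apply/esym; apply: (key h g i _ fi).1 => j; rewrite orbC.
  have /orP[fi|fi] := gh i; last exact: (key g h i gh fi).2.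
  by apply/esym; apply: (key h g i _ fi).2 => j; rewrite orbC.
move=> uv /andP[/eqP vi /eqP vi1]; rewrite vi vi1 mulg1.
have [ui|ui] := eqVneq (u.1 i) i; first by rewrite ui vi vi1 mul1g.
(* by injectivity u also moves the image of i, which v therefore fixes *)
have : fixes v (u.1 i).
  have /orP[/andP[/eqP uui _]|//] := uv (u.1 i).
  by move: ui; rewrite -{2}(bij_inj (finperm_bij u.1) uui) eqxx.
by move=> /andP[/eqP-> /eqP->]; rewrite mul1g.
Qed.

Lemma fixes_eventually g : exists d, forall i, (d <= i)%N -> fixes g i.
Proof.
have [d1 gd1] := finite_set_nat_bound (finperm_fin g.1).
have [d2 gd2] := finite_set_nat_bound (finseq_fin g.2).
exists (maxn d1 d2) => i; rewrite geq_max => /andP[d1i d2i].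
apply/andP; split; apply: contraT; first by move=> /gd1; rewrite ltnNge d1i.
by move=> /gd2; rewrite ltnNge d2i.
Qed.

Lemma fixes_conj g s i : fixes g (s^-1 i) ->
  fixes (wreath_perm G s * g * (wreath_perm G s)^-1) i.
Proof.
case/andP=> /eqP g1 /eqP g2; apply/andP.
split; apply/eqP => /=.
  change (s (g.1 (s^-1 i)) = i); rewrite g1; exact: finpermVK.
change (1 * g.2 (s^-1 i) * 1^-1 = 1 :> G).
by rewrite g2 invg1 !mulg1.
Qed.

Lemma wreath_permM s t :
  wreath_perm G (s * t) = wreath_perm G s * wreath_perm G t.
Proof. by apply: wreathP => i //=; rewrite mulg1. Qed.

(** Because [t^-1 * s] has support disjoint from that of [g], it commutes with
    [g]. *)
Lemma wreath_conj_eq_on g s t : (forall i, ~~ fixes g i -> s i = t i) ->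
  wreath_perm G s * g * (wreath_perm G s)^-1 =
  wreath_perm G t * g * (wreath_perm G t)^-1.
Proof.
move=> st; pose w : finperm := t^-1 * s.
have -> : s = t * w by rewrite mulVKg.
suff cw : wreath_perm G w * g = g * wreath_perm G w.
  by rewrite wreath_permM -(mulgA (wreath_perm G t)) cw invgM !mulgA mulgK.
apply: fixes_commute => i; case: (boolP (fixes g i)) => [_|gi]; rewrite ?orbT//.
rewrite orbF /fixes eqxx andbT; apply/eqP.
by change (t^-1 (s i) = i); rewrite st//; exact: finpermK.
Qed.

Lemma finperm_central_conj (R : realType) (phi : wreath G -> R[i]) :
  finperm_central phi ->
  forall g s, phi (wreath_perm G s * g * (wreath_perm G s)^-1) = phi g.
Proof. by move=> phic g s; rewrite -mulgA -phic mulgVK. Qed.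

Section Copies.
Variables (d : nat) (g : wreath G).
Hypothesis gd : forall i, (d <= i)%N -> fixes g i.

(** The conjugate of [g] supported in the [n]-th block. The support of [g] lies
    in the first [d] points; blocks of length [d.+1] are never empty. *)
Definition copy (n : nat) : wreath G :=
  let s := wreath_perm G (block d (swap 0 n)) in s * g * s^-1.

Lemma copy_fixes n i : (i %/ d.+1)%N != n -> fixes (copy n) i.
Proof.
move=> idn; apply: fixes_conj; apply: gd.
set s := block d (swap 0 n); set j := (s^-1 : finperm) i.
have ji : s j = i by exact: finpermVK.
rewrite leqNgt; apply: contra idn => jd.
have jd1 : (j < d.+1)%N by rewrite ltnS ltnW.
have -> : i = (n * d.+1 + j)%N.
  rewrite -ji; change (block_fun d (swap 0 n) j = n * d.+1 + j)%N.
  by rewrite -{1}[j]add0n -(mul0n d.+1) block_funE// (swapL 0 n).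
by rewrite divnMDl// divn_small// addn0.
Qed.

(** Both sides are conjugates of [g] by permutations that agree on the block
    number 0. *)
Lemma copy_conj n t :
  let s := wreath_perm G (block d t) in s * copy n * s^-1 = copy (t n).
Proof.
move=> s; rewrite /copy /s !mulgA -wreath_permM.
rewrite -!mulgA -invgM -wreath_permM !mulgA.
apply: wreath_conj_eq_on => i gi.
have id : (i < d.+1)%N.
  by rewrite ltnNge; apply: contra gi => /ltnW; exact: gd.
change (block_fun d t (block_fun d (swap 0 n) i) = block_fun d (swap 0 (t n)) i).
have -> : i = (0 * d.+1 + i)%N by rewrite mul0n.
by rewrite !block_funE.
Qed.

(** A finitary permutation of the blocks that moves the pair [(n, m)] to another
    one and fixes the support of [h] conjugates one argument of [phi] into the
    other, and a central [phi] does not see this conjugation. *)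
Lemma copy_gram (R : realType) (phi : wreath G -> R[i]) (h : wreath G) :
  finperm_central phi -> exists n0 c, forall n m, (n0 <= n)%N -> (n0 <= m)%N ->
    n != m -> phi ((copy m * h)^-1 * (copy n * h)) = c.
Proof.
move=> phic; have [n0 hn0] := fixes_eventually h.
pose F n m := (copy m * h)^-1 * (copy n * h).
exists n0, (phi (F n0 n0.+1)) => n m n0n n0m nm.
have [|||||| t [tn tm tfix]] :=
  @finperm_pair_transitive n0 n0 n0.+1 n m => //.
  by rewrite ltn_eqF.
pose s := wreath_perm G (block d t).
have sh : s * h = h * s.
  apply: fixes_commute => i; have [/hn0->|ii] := leqP n0 i; rewrite ?orbT//.
  rewrite /fixes eqxx andbT; apply/orP; left; apply/eqP.
  by apply: block_fun_fix; apply: tfix; exact: leq_ltn_trans (leq_div _ _) ii.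
have hs : h * s^-1 = s^-1 * h by rewrite -(mulKg s (h * _)) (mulgA s) sh mulgK.
have conjF k : s * (copy k * h) * s^-1 = copy (t k) * h.
  by rewrite -copy_conj -/s -!mulgA hs.
rewrite -(finperm_central_conj phic (F n0 _) (block d t)) /F -/s -tn -tm.
by rewrite -(conjF n0) -(conjF n0.+1) mulVg_conj.
Qed.

End Copies.
End Wreath.

(** * Commutants and sigma-weakly continuous functionals *)

Section Commutant.
Variables (R : realType) (H : hilbertType R).
Implicit Types (S M : set (H -> H)) (A B T : H -> H).

(** Each [T] only has to commute with the late [U N], so the limit may lie in a
    commutant that contains none of the [U N]. *)
Lemma commutant_contraction_lim S (U : nat -> H -> H) A :
  S `<=` @bounded_operators R H -> (forall N, contraction (U N)) ->
  (forall x, U N x @[N --> \oo] --> A x) ->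
  (forall T, S T -> \forall N \near \oo, U N \o T = T \o U N) ->
  commutant S A.
Proof.
move=> bS cU UA UT; split.
  exact: contraction_bounded (contraction_lim cU UA).
move=> T ST; apply/funext => x /=.
have h : U N (T x) @[N --> \oo] --> T (A x).
  have TU : T (U N x) @[N --> \oo] --> T (A x).
    apply: (@cvg_comp _ _ _ (fun N => U N x) T _ (nbhs (A x))); first exact: UA.
    exact: (bS _ ST).2.
  apply: cvg_trans TU; apply: near_eq_cvg.
  near=> N.
  have /(congr1 (fun f => f x)) // : U N \o T = T \o U N by near: N; exact: UT.
exact: (cvg_unique (@norm_hausdorff _ H) (UA _) h).
Unshelve. all: by end_near. Qed.

Lemma commutant_linear S (c : R[i]) A B : S `<=` @bounded_operators R H ->
  commutant S A -> commutant S B -> commutant S (c *: A + B).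
Proof.
move=> bS [[lA cA] AS] [[lB cB] BS]; split; first split.
- move=> a x y; rewrite /= !fctE lA lB !scalerDr !scalerA (mulrC c).
  by rewrite addrACA.
- by move=> x; apply: cvgD; [apply: cvgZl_tmp; exact: cA|exact: cB].
- move=> T ST; apply/funext => x /=; rewrite !fctE /=.
  have /(congr1 (fun f => f x)) /= -> := AS T ST.
  have /(congr1 (fun f => f x)) /= -> := BS T ST.
  by rewrite (bS _ ST).1.
Qed.

Lemma commutant0 S : S `<=` @bounded_operators R H -> commutant S 0.
Proof.
move=> bS; split; first split.
- by move=> a x y /=; rewrite scaler0 addr0.
- by move=> x; exact: cvg_cst.
- move=> T ST; apply/funext => x /=.
  by have := linearB_prop (bS _ ST).1 0 0; rewrite !subrr.
Qed.

Lemma commutant_bounded S : commutant S `<=` @bounded_operators R H.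
Proof. by move=> T []. Qed.

Section Combinations.
Variables (S : set (H -> H)) (I : Type) (c : I -> R[i]) (U : I -> H -> H).
Hypotheses (bS : S `<=` @bounded_operators R H).
Hypotheses (SU : forall i, commutant S (U i)).

Lemma commutant_comb (r : seq I) : commutant S (\sum_(i <- r) c i *: U i).
Proof.
elim: r => [|i r IH]; first by rewrite big_nil; exact: commutant0.
by rewrite big_cons; exact: commutant_linear.
Qed.

Lemma linear_functional_comb (f : (H -> H) -> R[i]) (r : seq I) :
  linear_functional_on (commutant S) f ->
  f (\sum_(i <- r) c i *: U i) = \sum_(i <- r) c i * f (U i).
Proof.
move=> lf; elim: r => [|i r IH]; last first.
  by rewrite !big_cons lf ?IH//; exact: commutant_comb.
rewrite !big_nil; apply: (@addrI _ (f 0)).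
have S0 := commutant0 bS.
by have := lf 1 _ _ S0 S0; rewrite scaler0 !addr0 mul1r => <-.
Qed.

End Combinations.

Lemma sigma_weak_functional_lim M (f : (H -> H) -> R[i]) (U : nat -> H -> H) A
    (l : R[i]) :
  sigma_weakly_continuous_on M f -> M A -> (forall N, M (U N)) ->
  (U : nat -> sigma_weak_topology H) @ \oo --> (A : sigma_weak_topology H) ->
  (forall N, f (U N) = l) -> f A = l.
Proof.
move=> /subspace_continuousP/(_ A) fc MA MU UA fU.
have h : f (U N) @[N --> \oo] --> f A.
  apply: cvg_trans (fc MA) => V /= VA; have [N0 _ UV] := UA _ VA.
  by exists N0 => // N /UV /=; apply; exact: MU.
have h2 : f (U N) @[N --> \oo] --> l.
  rewrite (_ : (fun N => f (U N)) = (fun=> l)); last exact/funext.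
  exact: cvg_cst.
exact: (cvg_unique (@norm_hausdorff _ R[i]) h h2).
Qed.

End Commutant.

(** * The central limit of the conjugates of an element *)

Section CentralLimit.
Variables (R : realType) (Gamma : topologicalGroupType).
Variables (phi : wreath Gamma -> R[i]) (phi_central : finperm_central phi).
Hypothesis phi_one : phi 1%g = 1.
Variables (H : hilbertType R) (pi : wreath Gamma -> H -> H) (xi : H).
Hypothesis pi_GNS : GNS_representation phi pi xi.
Let M := generated_algebra pi.

Let pi_linear g : linear (pi g). Proof. by case: pi_GNS => -[]. Qed.
Let piM g h x : pi (g * h)%g x = pi g (pi h x).
Proof. by case: pi_GNS => -[_ _ -> _]. Qed.

Lemma GNS_inner g h : inner (pi g xi) (pi h xi) = phi (h^-1 * g)%g.
Proof.
case: pi_GNS => -[_ _ _ iso] _ phiE.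
by rewrite phiE -(iso h _ xi) -piM mulVKg.
Qed.

Lemma unitary_norm g x : `|pi g x| = `|x|.
Proof.
case: pi_GNS => -[_ _ _ iso] _ _.
by apply/eqP; rewrite -(@eqrXn2 _ 2)// -!inner_norm iso.
Qed.

Lemma pi_contraction g : contraction (pi g).
Proof. by split=> [|x]; [exact: pi_linear|rewrite unitary_norm]. Qed.

Lemma range_pi_bounded : range pi `<=` @bounded_operators R H.
Proof. by move=> _ [g _ <-]; exact: contraction_bounded (pi_contraction g). Qed.

Lemma generated_algebra_pi g : M (pi g).
Proof.
split; first by apply: range_pi_bounded; exists g.
by move=> T [_ Tpi]; rewrite Tpi//; exists g.
Qed.

Variables (g : wreath Gamma) (d : nat).
Hypothesis gd : forall i, (d <= i)%N -> fixes g i.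

Definition copy_mean (N : nat) : H -> H :=
  N.+1%:R^-1 *: \sum_(k < N.+1) pi (copy d g (N ^ 2 + k)%N).

Lemma copy_meanE N x :
  copy_mean N x = window_mean (fun n => pi (copy d g n) x) N.
Proof. by rewrite /copy_mean /window_mean !fctE fct_sumE. Qed.

Lemma copy_mean_contraction N : contraction (copy_mean N).
Proof.
split=> [a x y|x]; rewrite !copy_meanE.
  rewrite /window_mean (eq_bigr _ (fun k _ => pi_linear _ a x y)) big_split /=.
  by rewrite -scaler_sumr scalerDr !scalerA [in LHS]mulrC.
rewrite normrZ normfV normr_nat ler_pdivrMl ?ltr0n//.
rewrite (le_trans (ler_norm_sum _ _ _))//.
rewrite (eq_bigr (fun=> `|x|)) => [|k _]; last exact: unitary_norm.
by rewrite sumr_const card_ord mulr_natl.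
Qed.

(** On a vector [pi h xi] the Gram matrix is computed by [phi]; the other
    vectors are reached by linearity and density. *)
Lemma copy_mean_cvg x : cvgn (fun N => copy_mean N x).
Proof.
apply: contraction_cvg_dense x; first exact: copy_mean_contraction.
  by case: pi_GNS => _ + _; exact.
move=> _ [n [c [h ->]]].
have ex : forall i, exists l : H, copy_mean N (pi (h i) xi) @[N --> \oo] --> l.
  move=> i; have [n0 [c0 gram]] := copy_gram gd (h i) phi_central.
  have : cvgn (window_mean (fun n => pi (copy d g n) (pi (h i) xi))).
    apply: (@window_mean_cvg _ _ _ n0 1 c0) => p q p0 q0.
    rewrite -!piM GNS_inner; case: eqVneq => [->|pq]; last exact: gram.
    by rewrite mulVg.
  rewrite (_ : window_mean _ = fun N => copy_mean N (pi (h i) xi)).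
    by move=> cv; exists (lim (copy_mean N (pi (h i) xi) @[N --> \oo])).
  by apply/funext => N; rewrite copy_meanE.
have [l hl] := choice ex.
apply/cvg_ex; exists (\sum_(i < n) c i *: l i).
rewrite (_ : (fun N => _) =
    (fun N => \sum_(i < n) c i *: copy_mean N (pi (h i) xi))).
  by apply: cvg_finite_sum => i; exact: cvgZl_tmp.
by apply/funext => N; apply: linear_comb; case: (copy_mean_contraction N).
Qed.

Definition copy_lim (x : H) : H := limn (fun N => copy_mean N x).

Lemma copy_meanP x : copy_mean N x @[N --> \oo] --> copy_lim x.
Proof. exact: copy_mean_cvg. Qed.

Lemma copy_mean_generated N : M (copy_mean N).
Proof.
rewrite /copy_mean scaler_sumr; apply: commutant_comb.
  exact: commutant_bounded.
by move=> k; exact: generated_algebra_pi.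
Qed.

(** Every element [h] of the wreath product has finite support, so it commutes
    with all copies of [g] that enter the late means. *)
Lemma copy_lim_center : center_of M copy_lim.
Proof.
have bC := @commutant_bounded R H (range pi).
have cr : commutant (range pi) copy_lim.
  apply: (commutant_contraction_lim range_pi_bounded copy_mean_contraction).
    exact: copy_meanP.
  move=> _ [h _ <-]; have [n0 hn0] := fixes_eventually h.
  exists n0 => // N /= n0N; apply/funext => x /=.
  rewrite !copy_meanE /window_mean.
  have pi_sum :
      pi h (N.+1%:R^-1 *: \sum_(k < N.+1) pi (copy d g (N ^ 2 + k)%N) x) =
      N.+1%:R^-1 *: \sum_(k < N.+1) pi h (pi (copy d g (N ^ 2 + k)%N) x).
    by rewrite scaler_sumr linear_comb// -scaler_sumr.
  rewrite pi_sum; congr (_ *: _); apply: eq_bigr => k _.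
  rewrite -!piM; congr (pi _ x).
  apply: fixes_commute => i; have [/hn0->|ii] := leqP n0 i; rewrite ?orbT//.
  rewrite (copy_fixes gd)// neq_ltn; apply/orP; left.
  by rewrite (leq_ltn_trans (leq_div _ _))// (leq_trans ii)//; nia.
split; last first.
  split; first exact: cr.1.
  by move=> B [_ BC]; rewrite BC.
apply: (commutant_contraction_lim bC copy_mean_contraction copy_meanP) => T CT.
by exists 0%N => // N _; have [_ ->] := copy_mean_generated N.
Qed.

(** The functional takes the value [f (pi g)] at every copy of [g], hence at
    all the means. *)
Lemma functional_copy_lim (f : (H -> H) -> R[i]) :
  linear_functional_on M f -> sigma_weakly_continuous_on M f ->
  (forall s a, M a ->
    f (pi (wreath_perm Gamma s) \o a) = f (a \o pi (wreath_perm Gamma s))) ->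
  f (pi g) = f copy_lim.
Proof.
move=> lf fc ftr.
apply/esym.
apply: (sigma_weak_functional_lim fc copy_lim_center.1 (U := copy_mean)).
- exact: copy_mean_generated.
- apply: contraction_sigma_weak_cvg; first exact: copy_mean_contraction.
  exact: copy_meanP.
move=> N; rewrite /copy_mean scaler_sumr.
rewrite (linear_functional_comb _ _ _ _ lf); last 2 first.
- exact: commutant_bounded.
- by move=> k; exact: generated_algebra_pi.
rewrite -mulr_sumr.
have fcopy n : f (pi (copy d g n)) = f (pi g).
  rewrite /copy; set s := wreath_perm _ _.
  have piE a b : pi (a * b)%g = pi a \o pi b by apply/funext => x; exact: piM.
  rewrite -mulgA piE ftr; last exact: generated_algebra_pi.
  by rewrite -piE mulgVK.
rewrite (eq_bigr (fun=> f (pi g))) => [|k _]; last exact: fcopy.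
by rewrite sumr_const card_ord -(mulr_natl (f _)) mulKf// pnatr_eq0.
Qed.
End CentralLimit.

Theorem theorem3 (R : realType) (Gamma : topologicalGroupType)
    (Gamma_separable : separable Gamma)
    (phi : wreath Gamma -> R[i])
    (phi_state : state phi) (phi_central : finperm_central phi)
    (H : hilbertType R) (pi : wreath Gamma -> H -> H) (xi : H)
    (pi_GNS : GNS_representation phi pi xi)
    (phi1 phi2 : (H -> H) -> R[i]) :
  let M := generated_algebra pi in
  linear_functional_on M phi1 -> linear_functional_on M phi2 ->
  positive_on M phi1 -> positive_on M phi2 ->
  sigma_weakly_continuous_on M phi1 -> sigma_weakly_continuous_on M phi2 ->
  (forall (s : finperm) (a : H -> H), M a ->
     phi1 (pi (wreath_perm Gamma s) \o a) = phi1 (a \o pi (wreath_perm Gamma s))) ->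
  (forall (s : finperm) (a : H -> H), M a ->
     phi2 (pi (wreath_perm Gamma s) \o a) = phi2 (a \o pi (wreath_perm Gamma s))) ->
  (forall c : H -> H, center_of M c -> phi1 c = phi2 c) ->
  forall a : H -> H, range pi a -> phi1 a = phi2 a.
Proof.
move=> M lin1 lin2 _ _ cont1 cont2 tr1 tr2 cen _ [g _ <-].
have [_ _ phi_one] := phi_state.
have [d gd] := fixes_eventually g.
have lim := functional_copy_lim phi_central phi_one pi_GNS gd.
rewrite (lim phi1 lin1 cont1 tr1) (lim phi2 lin2 cont2 tr2); apply: cen.
exact: (copy_lim_center phi_central phi_one pi_GNS gd).
Qed.
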